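(* Let $X=(X_1,\dots,X_n)$ be a random vector in $\mathbb{R}^n$ with range $[\![X]\!]$, $f:[\![X]\!]\to\mathbb{R}^q$ a query and $\mathfrak{M}:\mathbb{R}^q\to\mathbb{R}^q$ a mapping such that $\mathfrak{M}\circ f$ is $\epsilon$-noiselessly private, $\epsilon>0$. Let $i\in\{1,\dots,n\}$, $\psi_{i,v_{-i}}\in\Psi_i$, and $Y=\mathfrak{M}\circ f\circ\psi_{i,v_{-i}}\circ X$. Then the maximal leakage from $X_i$ to $Y$ satisfies $$\mathcal{L}_{\mathrm{c}}(X_i\to Y)\le\epsilon .$$
   Context: $[\![\cdot]\!]$ denotes the range (set of values) of a map on the underlying sample space $\Omega$. $x_{-i}$, $X_{-i}$ denote vectors with the $i$-th entry removed. $\mathfrak{M}\circ f$ is $\epsilon$-noiselessly private if the set $\{\mathfrak{M}(f(X(\omega))):\omega\in\Omega,\ X_{-i}(\omega)=x_{-i}\}$ has at most $2^\epsilon$ elements for all $i$ and all $x_{-i}\in[\![X_{-i}]\!]$. For $v_{-i}\in[\![X_{-i}]\!]$, $\psi_{i,v_{-i}}(x)=(v_1,\dots,v_{i-1},x_i,v_{i+1},\dots,v_n)$, and $\Psi_i=\{\psi_{i,v_{-i}}:v_{-i}\in[\![X_{-i}]\!]\}$. It is understood that $[\![X]\!]$ contains every vector with $i$-th entry in $[\![X_i]\!]$ and remaining entries $v_{-i}\in[\![X_{-i}]\!]$, so that $f\circ\psi_{i,v_{-i}}$ is defined. Maximal (stochastic) leakage from a random variable $A$ to a random variable $B$: $$\mathcal{L}_{\mathrm{c}}(A\to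 B)=\sup_{U-A-B-\hat U}\log_2\left(\frac{\mathbb{P}\{U=\hat U\}}{\max_{u}P_U(u)}\right),$$ where the supremum is over all random variables $U,\hat U$ taking values in the same finite, arbitrary alphabet such that $U-A-B-\hat U$ is a Markov chain in this order, and $P_U$ is the probability mass function of $U$. *)

(* Defs.v *)
From HB Require Import structures.
From mathcomp Require Import all_boot all_order all_algebra.
From mathcomp Require Import finmap.
From mathcomp Require Import all_classical all_reals all_analysis.

Set Implicit Arguments.
Unset Strict Implicit.
Unset Printing Implicit Defensive.

Import Order.TTheory GRing.Theory Num.Theory.

Local Open Scope classical_set_scope.
Local Open Scope ring_scope.

(* R^n is n.-tuple R, whose canonical sigma-algebra is the product one. *)

Definition drop_coord (R : Type) (n : nat) (i : 'I_n) (x : n.-tuple R) :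
    n.-1.-tuple R :=
  [tuple tnth x (lift i j) | j < n.-1].

(* psi_{i,v}(x) = (v_1, ..., v_{i-1}, x_i, v_{i+1}, ..., v_n), where v lists
   the n - 1 entries other than the i-th. *)
Definition splice (R : Type) (n : nat) (i : 'I_n) (v : n.-1.-tuple R)
    (x : n.-tuple R) : n.-tuple R :=
  [tuple if unlift i j is Some k then tnth v k else tnth x i | j < n].

(* fset_set is the empty fset on infinite sets, hence the explicit
   finiteness requirement. For a query defined only on range X, g is any
   extension of it: only the values g (X w) matter. *)
Definition noiselessly_private (R : realType) (n q : nat) (Omega : Type)
    (eps : R) (X : Omega -> n.-tuple R)
    (g : n.-tuple R -> q.-tuple R) : Prop :=
  forall (i : 'I_n) (x : n.-1.-tuple R),
    range (drop_coord i \o X) x ->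
    let outputs := [set g (X w) | w in [set w | drop_coord i (X w) = x]] in
    finite_set outputs /\ (#|` fset_set outputs|%fset)%:R <= 2 `^ eps.

Definition coord_rv (d : measure_display) (Omega : measurableType d)
    (R : realType) (P : probability Omega R) (n : nat)
    (X : {RV P >-> n.-tuple R}) (i : 'I_n) : {RV P >-> R} :=
  mfun_Sub (mem_set (measurableT_comp (measurable_tnth i)
                       (measurable_funPT X))).

(* The real function h o Z is a version of the conditional probability
   P(E | Z). *)
Definition is_cond_prob (d dZ : measure_display) (Omega : measurableType d)
    (TZ : measurableType dZ) (R : realType) (P : probability Omega R)
    (E : set Omega) (Z : Omega -> TZ) (h : TZ -> R) : Prop :=
  [/\ measurable_fun [set: TZ] h,
      P.-integrable [set: Omega] (EFin \o h \o Z) &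
      forall C : set TZ, measurable C ->
        (\int[P]_(w in Z @^-1` C) (h (Z w))%:E = P (E `&` Z @^-1` C))%E].

(* V and W are conditionally independent given Z:
   P(V \in S, W \in T | Z) = P(V \in S | Z) P(W \in T | Z) a.s.
   Versions exist and are almost surely unique, so the choice of versions is
   immaterial. *)
Definition cond_indep (d dV dZ dW : measure_display) (Omega : measurableType d)
    (TV : measurableType dV) (TZ : measurableType dZ)
    (TW : measurableType dW) (R : realType) (P : probability Omega R)
    (V : Omega -> TV) (Z : Omega -> TZ) (W : Omega -> TW) : Prop :=
  forall (S : set TV) (T : set TW), measurable S -> measurable T ->
    exists hS hT : TZ -> R,
      [/\ is_cond_prob P (V @^-1` S) Z hS,
          is_cond_prob P (W @^-1` T) Z hT &
          is_cond_prob P (V @^-1` S `&` W @^-1` T) Z (hS \* hT)].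

(* Every term is independent of all the previous ones given the last
   of them. *)
Definition markov_chain4 (d d1 d2 d3 d4 : measure_display)
    (Omega : measurableType d) (T1 : measurableType d1)
    (T2 : measurableType d2) (T3 : measurableType d3)
    (T4 : measurableType d4) (R : realType) (P : probability Omega R)
    (X1 : Omega -> T1) (X2 : Omega -> T2) (X3 : Omega -> T3)
    (X4 : Omega -> T4) : Prop :=
  cond_indep P X1 X2 X3 /\ cond_indep P (fun w => (X1 w, X2 w)) X3 X4.

Definition log2e (R : realType) (x : \bar R) : \bar R :=
  (lne x * ((ln 2)^-1)%:E)%E.

Definition guessing_gain (d dU : measure_display) (Omega : measurableType d)
    (TU : measurableType dU) (R : realType) (P : probability Omega R)
    (U U' : Omega -> TU) : \bar R :=
  log2e (P [set w | U w = U' w] /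
         \big[maxe/0%E]_(u \in [set: TU]) P (U @^-1` [set u]))%E.

(* U and U' need not live on the sample space of A and B: the supremum ranges
   over all quadruples (U, A', B', U') on some probability space such that
   (A', B') has the same joint law as (A, B).  The alphabet TU is finite with
   the discrete sigma-algebra. *)
Definition max_leakage (d dA dB : measure_display) (Omega : measurableType d)
    (TA : measurableType dA) (TB : measurableType dB) (R : realType)
    (P : probability Omega R) (A : {RV P >-> TA}) (B : {RV P >-> TB}) :
    \bar R :=
  ereal_sup [set l | exists (d' dU : measure_display)
      (Omega' : measurableType d') (TU : measurableType dU)
      (P' : probability Omega' R) (U U' : {RV P' >-> TU})
      (A' : {RV P' >-> TA}) (B' : {RV P' >-> TB}),
    [/\ finite_set [set: TU] /\ (forall S : set TU, measurable S),
        forall S : set (TA * TB), measurable S ->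
          P' [set w | S (A' w, B' w)] = P [set w | S (A w, B w)],
        markov_chain4 P' U A' B' U' &
        l = guessing_gain P' U U']].

(* Main.v *)
Require Import Defs.
From HB Require Import structures.
From mathcomp Require Import all_boot all_order all_algebra.
From mathcomp Require Import finmap.
From mathcomp Require Import all_classical all_reals all_analysis.

(** Let K be the finite set of values of Y, and U - A - B - U' a Markov chain
    with (A, B) distributed as (X_i, Y). Given B = y, the variables U and U'
    are independent, so
      P(U = U', B = y) = \sum_u P(U = u, B = y) P(U' = u | B = y)
                       <= max_u P(U = u).
    Summing over y in K, P(U = U') <= #|K| max_u P(U = u), and K has at most
    2^eps elements because each value of Y is an output of M o f at a point of
    the range of X whose entries other than the i-th are v. *)

Set Implicit Arguments.
Unset Strict Implicit.
Unset Printing Implicit Defensive.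

Import Order.TTheory GRing.Theory Num.Theory.

Local Open Scope classical_set_scope.
Local Open Scope ring_scope.

Lemma measurable_tuple_set1 (d : measure_display) (T : measurableType d)
    (n : nat) (y : n.-tuple T) :
  (forall t : T, measurable [set t]) -> measurable [set y].
Proof.
move=> mT.
have -> : [set y] = \bigcap_(j in [set: 'I_n]) ((@tnth n T)^~ j @^-1` [set tnth y j]).
  apply/seteqP; split => [x -> //|x xy].
  by apply: eq_from_tnth => j; exact: xy.
apply: fin_bigcap_measurable => // j _.
by rewrite -[_ @^-1` _]setTI; exact: measurable_tnth.
Qed.

(** The integrand [h \o Z] is constant on the fibre [Z = z], so the integral defining the version
    collapses to a product there. *)
Lemma cond_prob_atom (d dZ : measure_display) (Omega : measurableType d)
    (TZ : measurableType dZ) (R : realType) (P : probability Omega R)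
    (E : set Omega) (Z : Omega -> TZ) (h : TZ -> R) (z : TZ) :
  measurable [set z] -> measurable (Z @^-1` [set z]) -> is_cond_prob P E Z h ->
  ((h z)%:E * P (Z @^-1` [set z]) = P (E `&` Z @^-1` [set z]))%E.
Proof.
move=> mz mZz [_ _ /(_ _ mz) <-].
rewrite -integral_cst//; apply: eq_integral => w.
by rewrite inE /= => ->.
Qed.

(** Elementary conditional independence given [Z = z], multiplied by [P(Z = z)^2] to avoid division:
    both sides equal [hS z * hT z * P(Z = z)^2]. *)
Lemma cond_indep_atom (d dV dZ dW : measure_display) (Omega : measurableType d)
    (TV : measurableType dV) (TZ : measurableType dZ)
    (TW : measurableType dW) (R : realType) (P : probability Omega R)
    (V : Omega -> TV) (Z : Omega -> TZ) (W : Omega -> TW)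
    (S : set TV) (T : set TW) (z : TZ) :
  cond_indep P V Z W -> measurable S -> measurable T ->
  measurable [set z] -> measurable (Z @^-1` [set z]) ->
  (P (V @^-1` S `&` W @^-1` T `&` Z @^-1` [set z]) * P (Z @^-1` [set z]) =
   P (V @^-1` S `&` Z @^-1` [set z]) * P (W @^-1` T `&` Z @^-1` [set z]))%E.
Proof.
move=> VZW mS mT mz mZz; have [hS [hT [cS cT cST]]] := VZW S T mS mT.
rewrite -(cond_prob_atom mz mZz cS) -(cond_prob_atom mz mZz cT).
rewrite -(cond_prob_atom mz mZz cST) /= EFinM -!muleA; congr (_ * _)%E.
by rewrite muleCA.
Qed.

Lemma eq_set_bigcup (T U : Type) (V V' : T -> U) :
  [set w | V w = V' w] =
  \bigcup_(u in [set: U]) (V @^-1` [set u] `&` V' @^-1` [set u]).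
Proof.
apply/seteqP; split => [w /= Vw|w [u _] [/= -> ->]//].
by exists (V w).
Qed.

Lemma trivIset_preimageI (T : Type) (U : Type) (Z : T -> U) (A : U -> set T) :
  trivIset [set: U] (fun u => A u `&` Z @^-1` [set u]).
Proof. by move=> u u' _ _ [w [[_ /= <-] [_ /= <-]]]. Qed.

Section finite_alphabet.
Context (d dU dZ : measure_display) (Omega : measurableType d)
  (TU : measurableType dU) (TZ : measurableType dZ) (R : realType)
  (P : probability Omega R) (U U' : {RV P >-> TU}) (Z : {RV P >-> TZ}).
Hypothesis finU : finite_set [set: TU].
Hypothesis mU : forall u : TU, measurable [set u].
Hypothesis indep : cond_indep P U Z U'.

Lemma measurable_eq_RV : measurable [set w | U w = U' w].
Proof.
rewrite eq_set_bigcup; apply: fin_bigcup_measurable => // u _.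
by apply: measurableI; exact: measurable_funPTI.
Qed.

Lemma prob_guess_atom_le (z : TZ) (m : R) :
  measurable [set z] -> (forall u, P (U @^-1` [set u]) <= m%:E)%E -> 0 <= m ->
  (P ([set w | U w = U' w] `&` Z @^-1` [set z]) <= m%:E)%E.
Proof.
move=> mz Um m0.
have mUI u : measurable (U @^-1` [set u] `&` U' @^-1` [set u] `&` Z @^-1` [set z]).
  by apply: measurableI; [apply: measurableI|]; exact: measurable_funPTI.
have mU'I u : measurable (Z @^-1` [set z] `&` U' @^-1` [set u]).
  by apply: measurableI; exact: measurable_funPTI.
have mE := measurableI _ _ measurable_eq_RV (measurable_funPTI Z mz).
(* A null fibre is treated apart, since the main case cancels the factor [P(Z = z)]. *)
have [p0|p0] := eqVneq (P (Z @^-1` [set z])) 0%E.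
  apply: (@le_trans _ _ (P (Z @^-1` [set z]))); last by rewrite p0 lee_fin.
  by apply: le_measure; rewrite ?inE//; exact: measurable_funPTI.
have pfin : P (Z @^-1` [set z]) \is a fin_num
  by apply: fin_num_measure; exact: measurable_funPTI.
have pgt0 : (0 < P (Z @^-1` [set z]))%E by rewrite lt0e p0 measure_ge0.
(* After multiplication by [P(Z = z)], each summand on the left becomes
   [P(U = u, Z = z) * P(U' = u, Z = z)] by conditional independence. *)
rewrite -(lee_pmul2r pfin pgt0) eq_set_bigcup setI_bigcupl.
rewrite measure_fin_bigcup//; last first.
  have := @trivIset_preimageI _ _ U' (fun u => U @^-1` [set u] `&` Z @^-1` [set z]).
  by under [in X in X -> _]eq_fun do rewrite setIAC.
(* Total probability over the values of [U']; this turns the right-hand side into a sum over [u], so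
   that the comparison is termwise. *)
have Zpart : (\sum_(u \in [set: TU]) P (Z @^-1` [set z] `&` U' @^-1` [set u]) =
    P (Z @^-1` [set z]))%E.
  rewrite -measure_fin_bigcup//; last exact: trivIset_preimageI.
  congr (P _); apply/seteqP; split => [w [u _ []//]|w Zw].
  by exists (U' w).
rewrite ge0_mule_fsuml// -[in leRHS]Zpart ge0_mule_fsumr//.
apply: lee_fsum => // u _; rewrite (cond_indep_atom indep)//; last first.
  exact: measurable_funPTI.
rewrite [in leRHS]setIC; apply: lee_wpmul2r => //.
apply: le_trans (Um u); apply: le_measure; rewrite ?inE//; last exact: measurable_funPTI.
by apply: measurableI; exact: measurable_funPTI.
Qed.

(** Almost surely [Z] lies in [K], so the event [U = U'] splits, up to a null set, into one piece
    per element of [K], each of probability at most [m]. *)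
Lemma prob_guess_le (K : set TZ) (m : R) :
  finite_set K -> (forall z : TZ, measurable [set z]) -> P (Z @^-1` K) = 1%E ->
  (forall u, P (U @^-1` [set u]) <= m%:E)%E -> 0 <= m ->
  (P [set w | U w = U' w] <= ((#|` fset_set K|%fset)%:R * m)%:E)%E.
Proof.
move=> finK mZ PK Um m0.
have mK : measurable K by apply: countable_measurable => //; exact: finite_set_countable.
have mEZ z : measurable ([set w | U w = U' w] `&` Z @^-1` [set z]).
  by apply: measurableI; [exact: measurable_eq_RV | exact: measurable_funPTI].
have mEK : measurable ([set w | U w = U' w] `&` Z @^-1` K).
  by apply: measurableI; [exact: measurable_eq_RV | exact: measurable_funPTI].
have PKC : P (~` (Z @^-1` K)) = 0%E.
  by rewrite probability_setC ?PK ?subee//; exact: measurable_funPTI.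
rewrite (measureDI P measurable_eq_RV (measurable_funPTI Z mK)).
rewrite [X in (X + _)%E](_ : _ = 0%E) ?add0e; last first.
  apply: (@subset_measure0 _ _ _ P _ (~` (Z @^-1` K))).
  - by apply: measurableD; [exact: measurable_eq_RV | exact: measurable_funPTI].
  - by apply: measurableC; exact: measurable_funPTI.
  - exact: subDsetr.
  - exact: PKC.
apply: (@le_trans _ _ (\sum_(z \in K) m%:E)%E).
  apply: (@le_trans _ _ (\sum_(z \in K)
      P ([set w | U w = U' w] `&` Z @^-1` [set z]))%E); last first.
    by apply: lee_fsum => // z _; exact: prob_guess_atom_le.
  apply: content_sub_fsum => // w [Ew Kw].
  by exists (Z w).
rewrite fsumEFin// fsbig_finite// big_const_seq count_predT iter_addr addr0.
by rewrite mulr_natl.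
Qed.

End finite_alphabet.

Lemma log2e_le (R : realType) (x : \bar R) (eps : R) :
  (0 <= x)%E -> (x <= (2 `^ eps)%:E)%E -> (log2e x <= eps%:E)%E.
Proof.
move=> x0 xeps; have ln2 : 0 < ln (2 : R) by rewrite ln_gt0// ltr1n.
rewrite /log2e lee_pdivrMr// -EFinM -ln_powR -lne_EFin ?powR_gt0//.
by rewrite lee_lne// in_itv/= ?lee_fin ?powR_ge0 ?x0 ?leey.
Qed.

Lemma guessing_gain_le (d dU dZ : measure_display) (Omega : measurableType d)
    (TU : measurableType dU) (TZ : measurableType dZ) (R : realType)
    (P : probability Omega R) (U U' : {RV P >-> TU}) (Z : {RV P >-> TZ})
    (K : set TZ) (eps : R) :
  finite_set [set: TU] -> (forall u : TU, measurable [set u]) ->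
  cond_indep P U Z U' ->
  finite_set K -> (forall z : TZ, measurable [set z]) ->
  P (Z @^-1` K) = 1%E -> (#|` fset_set K|%fset)%:R <= 2 `^ eps ->
  (guessing_gain P U U' <= eps%:E)%E.
Proof.
move=> finU mU indep finK mZ PK cardK.
rewrite /guessing_gain; set m := (\big[_/_]_(_ \in _) _).
have mUu u : measurable (U @^-1` [set u]).
  exact: measurable_funPTI.
have Um u : (P (U @^-1` [set u]) <= m)%E.
  (* The maximum is indexed by its finite support, which omits the [u] of mass zero; for those the
     default value [0] gives the bound. *)
  have [Pu0|Pu0] := eqVneq (P (U @^-1` [set u])) 0%E.
    by rewrite Pu0; exact: bigmax_ge_id.
  apply: (le_bigmax_seq 0%E u xpredT (fun u => P (U @^-1` [set u]))) => //.
  rewrite in_finite_support ?inE/=; first by split => //; exact/eqP.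
  exact: sub_finite_set finU.
have m1 : (m <= 1)%E.
  rewrite /m; elim/big_ind: _ => // [x y x1 y1|u _]; first by rewrite ge_max x1.
  exact: probability_le1.
(* If the maximum were not positive, all fibres of [U] would be null, and so would their finite
   union [Omega]. *)
have m0 : (0 < m)%E.
  rewrite ltNge; apply/negP => m_le0.
  suff : P [set: Omega] = 0%E by rewrite probability_setT => /eqP; rewrite onee_eq0.
  have -> : [set: Omega] = \bigcup_(u in [set: TU]) (setT `&` U @^-1` [set u]).
    by apply/seteqP; split => // w _; exists (U w).
  rewrite measure_fin_bigcup//; last first.
  - by move=> u _; rewrite setTI.
  - exact: trivIset_preimageI.
  apply: fsbig1 => u _; rewrite setTI; apply/eqP.
  by rewrite eq_le measure_ge0 (le_trans (Um u) m_le0).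
have mfin : m \is a fin_num.
  by rewrite fin_numE gt_eqF ?lt_eqF ?(lt_trans _ m0)// (le_lt_trans m1) ?ltry.
(* The maximum is finite and positive, hence a real [r] whose extended inverse is the ordinary
   [r^-1]. *)
move: m0 Um m1; rewrite -(fineK mfin); move: (fine m) => r.
rewrite lte_fin => r0 Um _.
rewrite inver gt_eqF//; apply: log2e_le.
  by apply: mule_ge0 => //; rewrite lee_fin invr_ge0 ltW.
rewrite lee_pdivrMr//.
apply: le_trans (prob_guess_le finU mU indep finK mZ PK Um (ltW r0)) _.
by rewrite -EFinM lee_fin ler_pM2r.
Qed.

Lemma drop_coord_splice (R : Type) (n : nat) (i : 'I_n) (v : n.-1.-tuple R)
    (x : n.-tuple R) : drop_coord i (splice i v x) = v.
Proof. by apply: eq_from_tnth => j; rewrite !tnth_mktuple liftK. Qed.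

Lemma tnth_splice (R : Type) (n : nat) (i : 'I_n) (v : n.-1.-tuple R)
    (x : n.-tuple R) : tnth (splice i v x) i = tnth x i.
Proof. by rewrite tnth_mktuple unlift_none. Qed.

(** Test on the rectangles [S * setT]. This extracts [U - B - U'] from the last link of the Markov
    chain. *)
Lemma cond_indep_fst (d d1 d2 dZ dW : measure_display)
    (Omega : measurableType d) (T1 : measurableType d1)
    (T2 : measurableType d2) (TZ : measurableType dZ)
    (TW : measurableType dW) (R : realType) (P : probability Omega R)
    (V1 : Omega -> T1) (V2 : Omega -> T2) (Z : Omega -> TZ) (W : Omega -> TW) :
  cond_indep P (fun w => (V1 w, V2 w)) Z W -> cond_indep P V1 Z W.
Proof.
move=> indep S T mS mT.
have [//|hS [hT]] := indep (S `*` setT) T _ mT; first exact: measurableX.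
suff -> : (fun w => (V1 w, V2 w)) @^-1` (S `*` setT) = V1 @^-1` S.
  by move=> ?; exists hS, hT.
by apply/seteqP; split => [w []//|w Sw]; split.
Qed.

Theorem theorem5 (R : realType) (d : measure_display)
    (Omega : measurableType d) (P : probability Omega R) (n q : nat)
    (X : {RV P >-> n.-tuple R})
    (f : n.-tuple R -> q.-tuple R) (M : q.-tuple R -> q.-tuple R)
    (eps : R) (eps_gt0 : 0 < eps)
    (private : noiselessly_private eps X (M \o f))
    (i : 'I_n)
    (range_recombine : forall x : n.-tuple R,
      range (coord_rv X i) (tnth x i) ->
      range (drop_coord i \o X) (drop_coord i x) -> range X x)
    (v : n.-1.-tuple R) (v_range : range (drop_coord i \o X) v)
    (Y : {RV P >-> q.-tuple R})
    (Y_def : (Y : Omega -> q.-tuple R) = M \o f \o splice i v \o X) :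
  (max_leakage (coord_rv X i) Y <= eps%:E)%E.
Proof.
have [finK cardK] := private i v v_range; set K := image _ _ in finK cardK.
have mtuple (y : q.-tuple R) : measurable [set y].
  by apply: measurable_tuple_set1; exact: measurable_set1.
have mK : measurable K.
  by apply: countable_measurable => //; exact: finite_set_countable.
(* The vector [splice i v (X w)] has its [i]-th entry in the range of [X_i] and remaining entries
   [v]. By recombination it equals some [X w'], so [Y w] is one of the outputs counted by [K]. *)
have YK : Y @^-1` K = setT.
  apply/seteqP; split => // w _ /=; rewrite Y_def /=.
  have [| |w' _ Xw'] := range_recombine (splice i v (X w)).
  - by rewrite tnth_splice; exists w.
  - by rewrite drop_coord_splice.
  by exists w'; rewrite /= Xw' ?drop_coord_splice.
apply: ge_ereal_sup => g [d' [dU [W' [TU [P' [U [U' [A' [B' chain]]]]]]]]].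
have [[finU mU] law [_ /cond_indep_fst indep] ->] := chain.
apply: (guessing_gain_le finU _ indep finK) => //.
(* Written as an event on the pair [(A', B')], membership in [K] transfers to [Y] by equality of the
   joint laws. *)
have -> : B' @^-1` K = [set w | (setT `*` K) (A' w, B' w)].
  by apply/seteqP; split => [w|w []].
rewrite law; last exact: measurableX.
rewrite (_ : mkset _ = Y @^-1` K); first by rewrite YK; exact: probability_setT.
by apply/seteqP; split => [w []|w].
Qed.
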